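(* Let $k$ be a Mercer kernel on $\mathbb{X}=\mathbb{R}^{n_x}$ with $k\in C^4(\mathbb{X}\times\mathbb{X})$ and with RKHS $\mathcal{H}$, let $x^{(1)},\dots,x^{(N)}\in\mathbb{X}$, $\gamma>0$, $T>0$, and let $v:[0,T]\to\mathbb{R}^N$ be continuous on $[0,T]$ and differentiable on $(0,T)$. With the operators and matrices defined in the context, let $$\hat A=\widehat S^*K_\gamma^{-1}\widehat S_0,\qquad \hat B_m=\widehat S^*K_\gamma^{-1}(\widehat S_{e_m}-\widehat S_0)\ (m=1,\dots,n_u),\qquad \hat Bh=(\hat B_1h,\dots,\hat B_{n_u}h),$$ $$\hat V=\widehat S^*v,\qquad \dot{\hat V}=\widehat S^*\dot v,\qquad \hat q=\widehat S^*\mathbf{q},\qquad \hat D_r(\hat B\hat V)=\widehat S^*K_\gamma^{-1}\big[\mathcal{D}_r\big((\hat B\hat V)(x^{(i)})\big)\big]_{i=1}^N,$$ all in $\mathcal{H}$ (respectively operators on $\mathcal{H}$), where $\mathbf{q}=K_\gamma^{-1}q_{\mathsf X}$. Then solving the infinite-dimensional final-value problem $$\big\langle-\dot{\hat V}_t,k_x\big\rangle_{\mathcal{H}}=\big\langle\hat A\hat V_t+\hat q+\hat D_r(\hat B\hat V_t),k_x\big\rangle_{\mathcal{H}}\quad\text{for all }(t,x)\in(0,T)\times\mathbb{X},\qquad \langle\hat V_T,k_x\rangle_{\mathcal{H}}=0\quad\text{for all }x\in\mathbb{X},$$ is equivalent to solving the $N$-dimensional final-value problem $$\big\langle-\dot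 v_t,\mathbf{k}(x)\big\rangle=\big\langle \mathsf{A}v_t+\mathbf{q}+\mathbf{D}_r(\mathsf{B}v_t),\mathbf{k}(x)\big\rangle\quad\text{for all }(t,x)\in(0,T)\times\mathbb{X},\qquad \langle v_T,\mathbf{k}(x)\rangle=0\quad\text{for all }x\in\mathbb{X},$$ that is, $\hat V=\widehat S^*v$ satisfies the first problem if and only if $v$ satisfies the second. Here $\mathbf{k}(x)=[k(x^{(i)},x)]_{i=1}^N\in\mathbb{R}^N$, and $$\mathbf{D}_r(\mathsf{B}v)=K_\gamma^{-1}\big[\mathcal{D}_r\big(\langle \mathsf{B}v,\mathbf{k}(x^{(i)})\rangle\big)\big]_{i=1}^N,\qquad \langle\mathsf{B}v,\mathbf{k}(x)\rangle=\big(\langle\mathsf{B}_1v,\mathbf{k}(x)\rangle,\dots,\langle\mathsf{B}_{n_u}v,\mathbf{k}(x)\rangle\big)\in\mathbb{R}^{n_u}.$$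
   Context: Setting: a controlled diffusion $\mathrm{d}X_t=(f(X_t)+G(X_t)\pi(X_t))\,\mathrm{d}t+\sqrt{2\epsilon}\,\mathrm{d}W_t$ on $\mathbb{X}=\mathbb{R}^{n_x}$ with $f\in C^1(\mathbb{X})^{n_x}$, $G\in C^1(\mathbb{X})^{n_x\times n_u}$, $\epsilon>0$; a stage cost $q\in C^1(\mathbb{X})$ with samples $q_{\mathsf X}=[q(x^{(i)})]_{i=1}^N\in\mathbb{R}^N$; a control set $\mathbb{U}=\{u\in\mathbb{R}^{n_u}\mid u_-\le u\le u_+\}$ with nonempty interior; and a strongly convex control penalty $r\in C^1(\mathbb{U})$. The dual function is $\mathcal{D}_r(\lambda)=\min_{u\in\mathbb{U}}\{r(u)+\langle\lambda,u\rangle\}$ for $\lambda\in\mathbb{R}^{n_u}$. A Mercer kernel is a continuous, symmetric, positive semidefinite function $k:\mathbb{X}\times\mathbb{X}\to\mathbb{R}$; its RKHS $\mathcal{H}$ has $k_x=\phi(x)=k(\cdot,x)$ and reproducing property $h(x)=\langle h,k_x\rangle_{\mathcal{H}}$. For a constant input $\pi\in\{0,e_1,\dots,e_{n_u}\}$ ($e_j$ standard basis vectors of $\mathbb{R}^{n_u}$), the backward Fokker-Planck-Kolmogorov operator is $\mathcal{L}_\pi^*h=\langle f+G\pi,\nabla h\rangle+\epsilon\Delta h$, and $\psi_\pi(x)\in\mathcal{H}$ is the Riesz representer of $h\mapsto(\mathcal{L}_\pi^*h)(x)$ on $\mathcal{H}$ (for $k\in C^4$ one has $\mathcal{H}\subset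 C^2(\mathbb{X})$ and this functional is bounded). Data-based operators: $\widehat S:\mathcal{H}\to\mathbb{R}^N$, $\widehat Sh=[h(x^{(i)})]_{i=1}^N$; its adjoint $\widehat S^*:\mathbb{R}^N\to\mathcal{H}$, $\widehat S^*w=\sum_{i=1}^Nw_i\,k_{x^{(i)}}$; and $\widehat S_\pi:\mathcal{H}\to\mathbb{R}^N$, $\widehat S_\pi h=[\langle\psi_\pi(x^{(i)}),h\rangle_{\mathcal{H}}]_{i=1}^N$. Matrices: $K=\widehat S\widehat S^*=[k(x^{(i)},x^{(j)})]_{i,j=1}^N$, $K_\gamma=K+N\gamma I_N$, $K_\pi=\widehat S_\pi\widehat S^*\in\mathbb{R}^{N\times N}$, i.e. $(K_\pi)_{ij}=\langle f(x^{(i)})+G(x^{(i)})\pi,\nabla_{x^{(i)}}k(x^{(i)},x^{(j)})\rangle+\epsilon\,\mathrm{Tr}(\nabla^2_{x^{(i)}}k(x^{(i)},x^{(j)}))$ with derivatives in the first argument of $k$. Further $\mathsf{A}=K_\gamma^{-1}K_0$, $\mathsf{B}_i=K_\gamma^{-1}(K_{e_i}-K_0)\in\mathbb{R}^{N\times N}$ for $i=1,\dots,n_u$, and $\mathsf{B}=[\mathsf{B}_1\cdots\mathsf{B}_{n_u}]$, where $\mathsf{B}v$ stands for the tuple $(\mathsf{B}_1v,\dots,\mathsf{B}_{n_u}v)$. The estimated functions $\hat V_t$, $\hat q$ and $\hat D_r(\hat B\hat V_t)$ are those approximating the corresponding terms of the stochastic Hamilton-Jacobi-Bellman final-value problem $-\dot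 V=\mathcal{A}^*V+q+\mathcal{D}_r(\mathcal{B}^*V)$, $V(T)=0$. *)

(* Defs.v *)
From HB Require Import structures.
From mathcomp Require Import all_boot all_order all_algebra.
From mathcomp Require Import all_classical all_reals all_analysis.
Set Implicit Arguments.
Unset Strict Implicit.
Unset Printing Implicit Defensive.
Import Order.TTheory GRing.Theory Num.Theory.
Import numFieldNormedType.Exports.
Local Open Scope classical_set_scope.
Local Open Scope ring_scope.

Definition dot (R : realType) (n : nat) (u v : 'cV[R]_n) : R :=
  \sum_(i < n) u i 0 * v i 0.

Definition ebasis (R : realType) (n : nat) (i : 'I_n) : 'cV[R]_n :=
  delta_mx i 0.

Section Smoothness.
Context {R : realType}.

(* In finite dimension, x |-> 'd g x is of class C^m for the operator norm iff
   all its evaluations x |-> 'd g x w = 'D_w g x are. *)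
Fixpoint class_C (m : nat) (V : normedModType R) (g : V -> R) : Prop :=
  if m is m'.+1 then
    (forall x, differentiable g x) /\ (forall w, class_C m' ('D_w g))
  else continuous g.

(* C^1 on a closed box: restriction to it of a C^1 function. *)
Definition class_C1_on (V : normedModType R) (A : set V) (g : V -> R) : Prop :=
  exists g' : V -> R, class_C 1 g' /\ (forall x, A x -> g x = g' x).

Context {n : nat}.
Implicit Types (h : 'cV[R]_n -> R) (x : 'cV[R]_n).

Definition grad h x : 'cV[R]_n := \col_i 'D_(ebasis R i) h x.

Definition hessian h x : 'M[R]_n :=
  \matrix_(i, j) 'D_(ebasis R i) ('D_(ebasis R j) h) x.

Definition laplacian h x : R := \tr (hessian h x).

End Smoothness.

Section ControlPenalty.
Context {R : realType} {nu : nat}.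
Implicit Types (U : set 'cV[R]_nu) (r : 'cV[R]_nu -> R).

Definition box (um up : 'cV[R]_nu) : set 'cV[R]_nu :=
  [set u | forall i, um i 0 <= u i 0 /\ u i 0 <= up i 0].

(* The norm is the Euclidean one; the norm `|_| on 'cV[R]_nu is the sup norm. *)
Definition strongly_convex_on U r : Prop :=
  exists2 mu : R, 0 < mu &
    forall u v t, U u -> U v -> 0 <= t -> t <= 1 ->
      r (t *: u + (1 - t) *: v) <=
      t * r u + (1 - t) * r v - mu / 2 * t * (1 - t) * dot (u - v) (u - v).

(* The least element of A when there is one (0 otherwise). *)
Definition set_min (A : set R) : R := xget 0 (A `&` lbound A).

Definition dual_fun U r (lam : 'cV[R]_nu) : R :=
  set_min [set r u + dot lam u | u in U].

End ControlPenalty.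

Definition mercer (R : realType) (X : topologicalType) (k : X -> X -> R) :
    Prop :=
  [/\ continuous (fun p : X * X => k p.1 p.2),
      (forall x y, k x y = k y x) &
      (forall (m : nat) (y : 'I_m -> X) (c : 'I_m -> R),
         0 <= \sum_i \sum_j c i * c j * k (y i) (y j))].

(* Real Hilbert spaces: a complete normed module whose norm is induced by an
   inner product. *)
Record hilbert (R : realType) : Type := Hilbert {
  hilbert_sort :> completeNormedModType R ;
  ip : hilbert_sort -> hilbert_sort -> R ;
  ip_sym : forall g h, ip g h = ip h g ;
  ip_linear : forall a g g' h, ip (a *: g + g') h = a * ip g h + ip g' h ;
  ip_norm : forall h, ip h h = `|h| ^+ 2
}.

(* The elements of the space are functions on X through the injection [ev]
   (linear, by [reproducing]); [feat x] is the function k_x = k(., x). *)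
Record rkhs (R : realType) (X : Type) (k : X -> X -> R) : Type := RKHS {
  rkhs_hilbert :> hilbert R ;
  ev : rkhs_hilbert -> X -> R ;
  ev_inj : injective ev ;
  feat : X -> rkhs_hilbert ;
  ev_feat : forall x y, ev (feat x) y = k y x ;
  reproducing : forall h x, ev h x = ip h (feat x)
}.

Lemma ip_suml (R : realType) (H : hilbert R) (n : nat) (c : 'I_n -> R)
    (g : 'I_n -> H) (h : H) :
  ip (\sum_i c i *: g i) h = \sum_i c i * ip (g i) h.
Proof.
have ip0 : ip 0 h = 0.
  by have := ip_linear 1 0 0 h; rewrite scaler0 addr0 mul1r => /esym/eqP;
    rewrite -subr_eq0 addrK => /eqP.
elim: n c g => [|n IH] c g; first by rewrite !big_ord0.
by rewrite !big_ord_recl ip_linear IH.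
Qed.

(* The (unique) Riesz representer of F when F is linear and bounded. *)
Definition riesz (R : realType) (H : hilbert R) (F : H -> R) : H :=
  xget 0 [set p : H | forall h, ip p h = F h].

Section Operators.
Context {R : realType} {nx nu N : nat}.
Local Notation X := 'cV[R]_nx.
Local Notation U := 'cV[R]_nu.
Variables (f : X -> X) (G : X -> 'M[R]_(nx, nu)) (eps : R).
Variables (q : X -> R) (Dr : U -> R).
Variables (k : X -> X -> R) (xs : 'I_N -> X) (gam : R).
Variable H : rkhs k.

Definition bFPK (p : U) (h : X -> R) (x : X) : R :=
  dot (f x + G x *m p) (grad h x) + eps * laplacian h x.

Definition psi (p : U) (x : X) : H := riesz (fun h : H => bFPK p (ev h) x).

Definition S_hat (h : H) : 'cV[R]_N := \col_i ev h (xs i).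

Definition S_hat_adj (w : 'cV[R]_N) : H := \sum_i w i 0 *: feat H (xs i).

Lemma S_hat_adjE (w : 'cV[R]_N) (h : H) :
  ip (S_hat_adj w) h = dot w (S_hat h).
Proof.
rewrite ip_suml; apply: eq_bigr => i _.
by rewrite mxE reproducing ip_sym.
Qed.

Definition S_hat_in (p : U) (h : H) : 'cV[R]_N := \col_i ip (psi p (xs i)) h.

Definition K_mx : 'M[R]_N := \matrix_(i, j) k (xs i) (xs j).

Lemma K_mxE (w : 'cV[R]_N) : K_mx *m w = S_hat (S_hat_adj w).
Proof.
apply/colP => i; rewrite !mxE reproducing ip_suml; apply: eq_bigr => j _.
by rewrite mxE mulrC -reproducing ev_feat.
Qed.

Definition Kgam_mx : 'M[R]_N := K_mx + (N%:R * gam)%:M.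

Definition Kgam_inv : 'M[R]_N := invmx Kgam_mx.

(* Entries of the matrix of S_hat_in p \o S_hat_adj; the derivatives act on the
   first argument of k. *)
Definition K_in (p : U) : 'M[R]_N :=
  \matrix_(i, j) bFPK p (fun y => k y (xs j)) (xs i).

Definition A_mx : 'M[R]_N := Kgam_inv *m K_in 0.

Definition B_mx (m : 'I_nu) : 'M[R]_N :=
  Kgam_inv *m (K_in (ebasis R m) - K_in 0).

Definition q_vec : 'cV[R]_N := Kgam_inv *m \col_i q (xs i).

Definition k_vec (x : X) : 'cV[R]_N := \col_i k (xs i) x.

Definition B_eval (v : 'cV[R]_N) (x : X) : U :=
  \col_m dot (B_mx m *m v) (k_vec x).

Definition D_vec (v : 'cV[R]_N) : 'cV[R]_N :=
  Kgam_inv *m \col_i Dr (B_eval v (xs i)).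

Definition A_hat (h : H) : H := S_hat_adj (Kgam_inv *m S_hat_in 0 h).

Definition B_hat (m : 'I_nu) (h : H) : H :=
  S_hat_adj (Kgam_inv *m (S_hat_in (ebasis R m) h - S_hat_in 0 h)).

Definition B_hat_eval (h : H) (x : X) : U := \col_m ev (B_hat m h) x.

Definition q_hat : H := S_hat_adj q_vec.

Definition D_hat (h : H) : H :=
  S_hat_adj (Kgam_inv *m \col_i Dr (B_hat_eval h (xs i))).

Definition rkhs_fvp (T : R) (V dV : R -> H) : Prop :=
  (forall t x, 0 < t -> t < T ->
     ip (- dV t) (feat H x) =
     ip (A_hat (V t) + q_hat + D_hat (V t)) (feat H x)) /\
  (forall x, ip (V T) (feat H x) = 0).

Definition finite_fvp (T : R) (v dv : R -> 'cV[R]_N) : Prop :=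
  (forall t x, 0 < t -> t < T ->
     dot (- dv t) (k_vec x) =
     dot (A_mx *m v t + q_vec + D_vec (v t)) (k_vec x)) /\
  (forall x, dot (v T) (k_vec x) = 0).

End Operators.

(* Main.v *)
Require Import Defs.
From mathcomp Require Import all_boot all_order all_algebra.
From mathcomp Require Import all_classical all_reals all_analysis.
From mathcomp Require Import ring lra.
Import Order.TTheory GRing.Theory Num.Theory.
Import numFieldNormedType.Exports.
Local Open Scope classical_set_scope.
Local Open Scope ring_scope.

(** Write S for the sampling operator of the space H and S* for its adjoint. The
    right-hand side of the first problem, evaluated at [S* v], is [S*] of the
    right-hand side of the second, and [<S* w, k_x> = <w, k(x)>]
    ([ip_S_hat_adj_feat]). The two problems are thus the same equations at every
    (t, x). This rests on the identity [S_p (S* w) = K_p w] ([S_hat_in_adj]),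
    which turns the operators A and B on H into their matrices: entry i of the
    left side pairs psi_p(x_i) with a combination of the k_(x_j), and should
    give the values at x_i of the backward operator applied to the k(., x_j).

    The only analytic point is that psi_p(x) really represents the functional
    sending h to the backward operator applied to h at x ([ip_psi]). A
    representer is built explicitly rather than from the Riesz theorem: if the
    feature map, sending x to k_x, has directional derivatives in H, then
    differentiating [h(x) = <k_x, h>] gives
    [D_e h(x) = <D_e k_x, h>] and [D_e D_e h(x) = <D_e D_e k_x, h>], and the
    representer is a combination of such derivatives.

    Differentiability comes from a general fact ([feature_derivable]): a map F
    into a Hilbert space with [<F x, F y> = kk (x, y)], kk of class C^2, is
    derivable in every direction. By two applications of the mean value theorem,
    the inner product of two difference quotients of F at x is a value of a
    mixed second derivative of kk near (x, x), so all these inner products tend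
    to the same limit L, and the squared distance of two quotients tends to
    L - 2 L + L = 0; completeness gives the derivative. The derivative D_e F has
    in turn a Gram function, the mixed second derivative of kk
    ([gram_derive]). For the feature map kk is k, of class C^4, so this Gram
    function is again of class C^2 and the same fact yields the second
    derivative. *)

(** * Inner products and limits *)

Section InnerProduct.
Context {R : realType} {H : hilbert R}.
Implicit Types (g h : H) (a : R).

Lemma ipDl g g' h : ip (g + g') h = ip g h + ip g' h.
Proof. by rewrite -[g]scale1r ip_linear mul1r scale1r. Qed.

Lemma ip0l h : ip 0 h = 0.
Proof. by apply: (addrI (ip 0 h)); rewrite -ipDl !addr0. Qed.

Lemma ipZl a g h : ip (a *: g) h = a * ip g h.
Proof. by rewrite -[a *: g]addr0 ip_linear ip0l addr0. Qed.

Lemma ipBl g g' h : ip (g - g') h = ip g h - ip g' h.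
Proof. by rewrite ipDl -scaleN1r ipZl mulN1r. Qed.

Lemma ipBr g h h' : ip g (h - h') = ip g h - ip g h'.
Proof. by rewrite ip_sym ipBl !(ip_sym _ g). Qed.

Lemma ipZr a g h : ip g (a *: h) = a * ip g h.
Proof. by rewrite ip_sym ipZl ip_sym. Qed.

Lemma ip_polarization g h :
  ip g h = (`|g + h| ^+ 2 - `|g| ^+ 2 - `|h| ^+ 2) / 2.
Proof.
rewrite -!ip_norm ipDl !(ip_sym _ (g + h)) !ipDl (ip_sym h g); lra.
Qed.

(** Polarization expresses the inner product through the norm, whose continuity
    is known. *)
Lemma ip_continuous h : continuous (fun g => ip g h).
Proof.
move=> g; rewrite (_ : (fun _ => _) =
  fun g => (`|g + h| ^+ 2 - `|g| ^+ 2 - `|h| ^+ 2) / 2); last first.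
  by apply/funext => g'; exact: ip_polarization.
have cn (u : H -> H) : {for g, continuous u} ->
    `|u x| ^+ 2 @[x --> g] --> `|u g| ^+ 2.
  by move=> cu; rewrite expr2; apply: cvgM; apply: cvg_norm.
apply: cvgM; last exact: cvg_cst.
apply: cvgB; last exact: cvg_cst.
apply: cvgB; last exact: (cn id).
by apply: (cn (fun x => x + h)); apply: cvgD; [exact: cvg_id|exact: cvg_cst].
Qed.

Lemma is_derive_ip {V : normedModType R} {F : V -> H} {x e : V} h :
  derivable F x e ->
  is_derive x e (fun y => ip (F y) h) (ip ('D_e F x) h).
Proof.
move=> dF.
have lim_quot : (t^-1 *: (((fun y => ip (F y) h) \o shift x) (t *: e) -
    ip (F x) h)) @[t --> 0^'] --> ip ('D_e F x) h.
  rewrite (_ : (fun t => _) = (fun g => ip g h) \o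
    (fun t => t^-1 *: ((F \o shift x) (t *: e) - F x))); last first.
    by apply/funext => t /=; rewrite ipZl ipBl.
  by apply: (continuous_cvg _ (ip_continuous h ('D_e F x))); exact: dF.
apply: DeriveDef; first by apply/cvg_ex; exists (ip ('D_e F x) h).
exact: (cvg_lim (@norm_hausdorff _ _)).
Qed.

End InnerProduct.

(** * Directional derivatives *)

Lemma class_CS_pred {R : realType} m (V : normedModType R) (g : V -> R) :
  class_C m.+1 g -> class_C m g.
Proof.
elim: m g => [|m IH] g [dg Dg].
  by move=> x; exact: differentiable_continuous.
by split=> // w; apply: IH.
Qed.

(** A directional derivative depends only on the increments along its direction.
    This transfers derivatives between a map and its restriction to a line, its
    translates and its partial maps. *)
Section IncrementsAndDerivative.
Context {R : realType} {V V' W : normedModType R}.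
Variables (g : V -> W) (g' : V' -> W) (x v : V) (x' v' : V').
Hypothesis eq_incr :
  forall h : R, g (h *: v + x) - g x = g' (h *: v' + x') - g' x'.

Let eq_quot : (fun h : R => h^-1 *: ((g \o shift x) (h *: v) - g x)) =
  (fun h : R => h^-1 *: ((g' \o shift x') (h *: v') - g' x')).
Proof. by apply/funext => h; congr (_ *: _); exact: eq_incr. Qed.

Lemma eq_incr_derivable : derivable g x v = derivable g' x' v'.
Proof. by rewrite /derivable eq_quot. Qed.

Lemma eq_incr_derive : 'D_v g x = 'D_v' g' x'.
Proof. by rewrite /derive eq_quot. Qed.

End IncrementsAndDerivative.
Arguments eq_incr_derivable {R V V' W g g' x v x' v'}.
Arguments eq_incr_derive {R V V' W g g' x v x' v'}.

(** The restriction of g to the segment from p to p + s w is parametrized by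
    [0, 1], so that s may have either sign or vanish. *)
Lemma mean_value_line {R : realType} {V : normedModType R} (g : V -> R)
    (p w : V) (s : R) : (forall x, differentiable g x) ->
  exists2 a : R, `|a| <= `|s| & g (p + s *: w) - g p = s * 'D_w g (p + a *: w).
Proof.
move=> dg; pose u (t : R) := g (p + t *: (s *: w)).
have du (t : R) : is_derive t 1 u (s * 'D_w g (p + t *: (s *: w))).
  have dsw : derivable g (p + t *: (s *: w)) (s *: w) by exact: diff_derivable.
  have eq_incr (h : R) : u (h *: 1 + t) - u t =
      g (h *: (s *: w) + (p + t *: (s *: w))) - g (p + t *: (s *: w)).
    by rewrite /u scalerDl [_ *: 1]mulr1 addrCA.
  apply: DeriveDef; first by rewrite (eq_incr_derivable eq_incr).
  by rewrite (eq_incr_derive eq_incr) !deriveE// linearZ.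
have u_cont : {within `[0, 1], continuous u}.
  by apply: derivable_within_continuous => t _; case: (du t).
have [c] := MVT ltr01 (fun t _ => du t) u_cont.
rewrite in_itv /= => /andP[c0 c1].
rewrite /u scale1r scale0r addr0 subr0 mulr1 => ->.
exists (c * s); last by rewrite scalerA.
by rewrite normrM ger0_norm ?(ltW c0)// ler_piMl// ltW.
Qed.

(** * Differentiability of a map with a smooth Gram function *)

Section DifferentiableFeature.
Context {R : realType} {V : normedModType R} {H : hilbert R}.
Variables (kk : V * V -> R) (F : V -> H) (e : V).
Hypothesis F_gram : forall x y, ip (F x) (F y) = kk (x, y).
Hypothesis kk_C2 : class_C 2 kk.

Let kk_diff p : differentiable kk p.
Proof. by case: kk_C2. Qed.

Let Dkk_diff w p : differentiable ('D_w kk) p.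
Proof. by have [_ /(_ w)[]] := kk_C2. Qed.

Let DDkk_cont w w' : continuous ('D_w' ('D_w kk)).
Proof. by have [_ /(_ w)[_ /(_ w')]] := kk_C2. Qed.

(** The inner product of two increments of F is a rectangular second difference
    of kk. The mean value theorem is applied first, along the first variable, to
    the increment of kk in its second variable, and then to D_(e, 0) kk along
    the second variable. *)
Let second_difference x s t :
  exists a b : R, [/\ `|a| <= `|s|, `|b| <= `|t| &
    ip (F (x + s *: e) - F x) (F (x + t *: e) - F x) =
    s * t * 'D_(0, e) ('D_(e, 0) kk) (x + a *: e, x + b *: e)].
Proof.
pose c : V * V := t *: (0, e).
have shift_diff p : differentiable (fun p => kk (p + c)) p.
  apply: (@differentiable_comp _ _ _ _ (fun p => p + c) kk) => //.
have [p|a as_ sE] := @mean_value_line _ _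
    (fun p => kk (p + c) - kk p) (x, x) (e, 0) s.
  exact: differentiableB.
have [|b bt tE] := @mean_value_line _ _ ('D_(e, 0) kk)
    ((x, x) + a *: (e, 0)) (0, e) t.
  exact (Dkk_diff (e, 0)).
exists a, b; split; [exact: as_|exact: bt|].
have pairD (u v u' v' : V) : ((u, v) : V * V) + (u', v') = (u + u', v + v').
  by [].
have pairZ (z : R) (u v : V) : z *: ((u, v) : V * V) = (z *: u, z *: v).
  by [].
have -> : ip (F (x + s *: e) - F x) (F (x + t *: e) - F x) =
   kk ((x, x) + s *: (e, 0) + c) - kk ((x, x) + s *: (e, 0)) -
   (kk ((x, x) + c) - kk (x, x)).
  rewrite !(ipBl, ipBr) !F_gram /c !(pairZ, pairD) !scaler0 !addr0.
  ring.
rewrite sE -mulrA; congr (_ * _).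
have -> : (x + a *: e, x + b *: e) = (x, x) + a *: (e, 0) + b *: (0, e).
  by rewrite !(pairZ, pairD) !scaler0 !addr0.
have shift_derive p : 'D_(e, 0) (fun p => kk (p + c)) p = 'D_(e, 0) kk (p + c).
  by apply: eq_incr_derive => h; rewrite addrA.
rewrite -tE deriveB; [|exact: diff_derivable|exact: diff_derivable].
by rewrite shift_derive.
Qed.

Let DDkk_near x d : 0 < d -> exists2 del : R, 0 < del &
  forall a b : R, `|a| < del -> `|b| < del ->
  `|'D_(0, e) ('D_(e, 0) kk) (x, x) -
    'D_(0, e) ('D_(e, 0) kk) (x + a *: e, x + b *: e)| < d.
Proof.
move=> d0.
have line_cvg : (x + a *: e) @[a --> (0 : R)] --> x.
  rewrite -[X in _ --> X]addr0 -[X in _ --> _ + X](scale0r e).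
  apply: cvgD; first exact: cvg_cst.
  by apply: cvgZr_tmp; exact: cvg_id.
have xx_cvg : (x + p.1 *: e, x + p.2 *: e) @[p --> ((0, 0) : R * R)] --> (x, x).
  apply: cvg_pair => /=.
    by apply: (cvg_comp _ _ cvg_fst line_cvg).
  by apply: (cvg_comp _ _ cvg_snd line_cvg).
have DD_cvg : 'D_(0, e) ('D_(e, 0) kk) (x + p.1 *: e, x + p.2 *: e)
    @[p --> ((0, 0) : R * R)] --> 'D_(0, e) ('D_(e, 0) kk) (x, x).
  exact: (continuous_cvg _ (@DDkk_cont (e, 0) (0, e) (x, x)) xx_cvg).
have /cvgrPdist_lt /(_ d d0) /nbhs_ballP[del /= del0 near_del] := DD_cvg.
exists del => // a b ad bd; apply: (near_del (a, b)); split => /=;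
  by rewrite /ball /= sub0r normrN.
Qed.

(** The difference quotients Q of F at x form a Cauchy family: all inner products
    [<Q s, Q t>] are close to the same number L, the mixed derivative at (x, x),
    hence so is the squared distance
    [<Q s, Q s> - 2 <Q s, Q t> + <Q t, Q t>] to 0. *)
Lemma feature_derivable x : derivable F x e.
Proof.
apply/cauchy_cvgP; apply: cauchy_exP => d d0.
pose L := 'D_(0, e) ('D_(e, 0) kk) (x, x).
(* With four inner products within d^2 / 8 of L, the squared distance is less
   than d^2 / 2. *)
have e0 : 0 < d ^+ 2 / 8 by rewrite divr_gt0// exprn_gt0.
have [del del0 near_L] := @DDkk_near x _ e0.
pose Q (t : R) := t^-1 *: ((F \o shift x) (t *: e) - F x).
have gramQ (s t : R) : s != 0 -> t != 0 -> `|s| < del -> `|t| < del ->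
    `|L - ip (Q s) (Q t)| < d ^+ 2 / 8.
  move=> s0 t0 sd td; rewrite /Q /= ipZl ipZr /shift /= ![_ *: e + x]addrC.
  have [a [b [as_ bt ->]]] := second_difference x s t.
  set DD := 'D_(0, e) _ _.
  rewrite (_ : s^-1 * (t^-1 * (s * t * DD)) = DD); last first.
    by field; rewrite ?s0 ?t0.
  by apply: near_L; [exact: le_lt_trans as_ sd|exact: le_lt_trans bt td].
have s0 : del / 2 != 0 by rewrite gt_eqF// divr_gt0.
have sd : `|del / 2| < del.
  by rewrite gtr0_norm ?divr_gt0// gtr_pMr// invf_lt1// ltr1n.
exists (Q (del / 2)).
have := @dnbhs_ball _ _ (0 : R) _ del0; apply: filterS => t [].
rewrite -!ball_normE /= sub0r normrN => td /eqP t0.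
rewrite -/(Q t) -(@ltr_pXn2r _ 2)// ?nnegrE ?(ltW d0)//.
rewrite -ip_norm !(ipBl, ipBr) (ip_sym (Q t)).
have := gramQ _ _ s0 s0 sd sd; have := gramQ _ _ t0 t0 td td.
have := gramQ _ _ s0 t0 sd td; rewrite !ltr_norml.
move=> /andP[? ?] /andP[? ?] /andP[? ?].
lra.
Qed.

(** Both arguments are differentiated one after the other inside the inner
    product. The Gram function of D_e F is thus a derivative of kk, so that
    [feature_derivable] can be applied to D_e F itself when kk is smooth
    enough. *)
Lemma gram_derive x y :
  ip ('D_e F x) ('D_e F y) = 'D_(e, 0) ('D_(0, e) kk) (x, y).
Proof.
have ip_right x' : ip (F x') ('D_e F y) = 'D_(0, e) kk (x', y).
  rewrite ip_sym.
  rewrite -(derive_val (is_derive := is_derive_ip (F x') (feature_derivable y))).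
  apply: eq_incr_derive => h; rewrite !(ip_sym _ (F x')) !F_gram.
  rewrite (_ : h *: (0, e) + (x', y) = (h *: 0 + x', h *: e + y))//.
  by rewrite scaler0 add0r.
have dFx := is_derive_ip ('D_e F y) (feature_derivable x).
rewrite -(derive_val (is_derive := dFx)).
apply: eq_incr_derive => h; rewrite !ip_right.
rewrite (_ : h *: (e, 0) + (x, y) = (h *: e + x, h *: 0 + y))//.
by rewrite scaler0 add0r.
Qed.

End DifferentiableFeature.

(** * The representer of the backward operator *)

Section RieszRepresenter.
Context {R : realType} {nx nu : nat} {k : 'cV[R]_nx -> 'cV[R]_nx -> R}.
Variable H : rkhs k.
Variables (f : 'cV[R]_nx -> 'cV[R]_nx) (G : 'cV[R]_nx -> 'M[R]_(nx, nu)).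
Variable eps : R.
Hypothesis k_C4 : class_C 4 (fun p : 'cV[R]_nx * 'cV[R]_nx => k p.1 p.2).

Let kp (p : 'cV[R]_nx * 'cV[R]_nx) := k p.1 p.2.

Lemma feat_gram x y : ip (feat H x) (feat H y) = kp (x, y).
Proof. by rewrite ip_sym -reproducing ev_feat. Qed.

Let kp_C2 : class_C 2 kp.
Proof. exact: (class_CS_pred _ _ _ (class_CS_pred _ _ _ k_C4)). Qed.

Lemma feat_derivable x e : derivable (feat H) x e.
Proof. exact: (feature_derivable kp (feat H) e feat_gram kp_C2 x). Qed.

(** The Gram function of [D_e (feat H)] is a second derivative of k, of class C^2
    because k is of class C^4. *)
Lemma derive_feat_derivable x e : derivable ('D_e (feat H)) x e.
Proof.
have Dkp_C2 : class_C 2 ('D_(e, 0) ('D_(0, e) kp)).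
  by have [_ /(_ (0, e))[_ /(_ (e, 0))]] := k_C4.
have Dgram := gram_derive kp (feat H) e feat_gram kp_C2.
exact: (feature_derivable _ ('D_e (feat H)) e Dgram Dkp_C2 x).
Qed.

Lemma derive_ev (h : H) x e : 'D_e (ev h) x = ip ('D_e (feat H) x) h.
Proof.
have -> : ev h = fun y => ip (feat H y) h.
  by apply/funext => y; rewrite reproducing ip_sym.
exact: (derive_val (is_derive := is_derive_ip h (feat_derivable x e))).
Qed.

Lemma derive2_ev (h : H) x e :
  'D_e ('D_e (ev h)) x = ip ('D_e ('D_e (feat H)) x) h.
Proof.
have -> : 'D_e (ev h) = fun y => ip ('D_e (feat H) y) h.
  by apply/funext => y; exact: derive_ev.
exact: (derive_val (is_derive := is_derive_ip h (derive_feat_derivable x e))).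
Qed.

(** The existence of a representer is what gives content to the value chosen by
    [riesz], which is 0 otherwise. *)
Lemma ip_psi p x (h : H) : ip (psi f G eps H p x) h = bFPK f G eps p (ev h) x.
Proof.
suff represented : exists g : H, forall h', ip g h' = bFPK f G eps p (ev h') x.
  exact: (xgetPex 0 represented h).
exists (\sum_i (f x + G x *m p) i 0 *: 'D_(ebasis R i) (feat H) x +
  \sum_i eps *: 'D_(ebasis R i) ('D_(ebasis R i) (feat H)) x) => g.
rewrite ipDl !ip_suml -mulr_sumr /bFPK /dot /laplacian /mxtrace.
congr (_ + _ * _); apply: eq_bigr => i _.
  by rewrite [grad _ _ _ _]mxE derive_ev.
by rewrite mxE derive2_ev.
Qed.

Context {N : nat} (xs : 'I_N -> 'cV[R]_nx).

Lemma S_hat_in_adj p (w : 'cV[R]_N) :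
  S_hat_in f G eps xs p (S_hat_adj xs H w) = K_in f G eps k xs p *m w.
Proof.
apply/colP => i; rewrite !mxE ip_sym ip_suml; apply: eq_bigr => j _.
have evE : ev (feat H (xs j)) = fun y => k y (xs j).
  by apply/funext => y; exact: ev_feat.
by rewrite ip_sym ip_psi evE mxE mulrC.
Qed.

End RieszRepresenter.

(** * The span of the sampled features *)

Section SampleSpan.
Context {R : realType} {nx N : nat} {k : 'cV[R]_nx -> 'cV[R]_nx -> R}.
Variables (H : rkhs k) (xs : 'I_N -> 'cV[R]_nx).

Lemma ip_S_hat_adj_feat w x :
  ip (S_hat_adj xs H w) (feat H x) = dot w (k_vec k xs x).
Proof.
by rewrite S_hat_adjE; congr dot; apply/colP => i; rewrite !mxE ev_feat.
Qed.

Lemma S_hat_adjD w w' :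
  S_hat_adj xs H (w + w') = S_hat_adj xs H w + S_hat_adj xs H w'.
Proof. by rewrite -big_split; apply: eq_bigr => i _; rewrite mxE scalerDl. Qed.

Lemma S_hat_adjN w : S_hat_adj xs H (- w) = - S_hat_adj xs H w.
Proof. by rewrite -sumrN; apply: eq_bigr => i _; rewrite mxE scaleNr. Qed.

End SampleSpan.

Theorem proposition2 (R : realType) (nx nu N : nat)
    (f : 'cV[R]_nx -> 'cV[R]_nx) (G : 'cV[R]_nx -> 'M[R]_(nx, nu)) (eps : R)
    (q : 'cV[R]_nx -> R) (um up : 'cV[R]_nu) (r : 'cV[R]_nu -> R)
    (k : 'cV[R]_nx -> 'cV[R]_nx -> R) (H : rkhs k)
    (xs : 'I_N -> 'cV[R]_nx) (gam T : R) (v : R -> 'cV[R]_N)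
    (f_C1 : forall i, class_C 1 (fun x => f x i 0))
    (G_C1 : forall i j, class_C 1 (fun x => G x i j))
    (eps_gt0 : 0 < eps)
    (q_C1 : class_C 1 q)
    (U_int : interior (box um up) !=set0)
    (r_C1 : class_C1_on (box um up) r)
    (r_sconv : strongly_convex_on (box um up) r)
    (k_mercer : mercer k)
    (k_C4 : class_C 4 (fun p : 'cV[R]_nx * 'cV[R]_nx => k p.1 p.2))
    (gam_gt0 : 0 < gam) (T_gt0 : 0 < T)
    (v_cont : {within `[0, T], continuous v})
    (v_diff : forall t, 0 < t -> t < T -> derivable v t 1) :
  rkhs_fvp f G eps q (dual_fun (box um up) r) xs gam T
    (fun t => S_hat_adj xs H (v t)) (fun t => S_hat_adj xs H (derive1 v t))
  <->
  finite_fvp f G eps q (dual_fun (box um up) r) k xs gam T v (derive1 v).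
Proof.
set Dr := dual_fun _ _.
have hat_in := S_hat_in_adj H f G eps k_C4 xs.
have A_hatE w : A_hat f G eps xs gam (S_hat_adj xs H w) =
    S_hat_adj xs H (A_mx f G eps k xs gam *m w).
  by rewrite /A_hat hat_in mulmxA.
have B_hatE w x : B_hat_eval f G eps xs gam (S_hat_adj xs H w) x =
    B_eval f G eps k xs gam w x.
  apply/colP => m; rewrite !mxE reproducing /B_hat !hat_in -mulmxBl mulmxA.
  exact: ip_S_hat_adj_feat.
have D_hatE w : D_hat f G eps Dr xs gam (S_hat_adj xs H w) =
    S_hat_adj xs H (D_vec f G eps Dr k xs gam w).
  rewrite /D_hat /D_vec; congr (S_hat_adj _ _ (_ *m _)).
  by apply/colP => i; rewrite !mxE B_hatE.
have rhsE w x : ip (A_hat f G eps xs gam (S_hat_adj xs H w) + q_hat q xs gam H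
      + D_hat f G eps Dr xs gam (S_hat_adj xs H w)) (feat H x) =
    dot (A_mx f G eps k xs gam *m w + q_vec q k xs gam
      + D_vec f G eps Dr k xs gam w) (k_vec k xs x).
  by rewrite A_hatE D_hatE -!S_hat_adjD ip_S_hat_adj_feat.
split=> -[ode final]; split=> [t x t0 tT|x].
- by rewrite -rhsE -ode// -(ip_S_hat_adj_feat H) S_hat_adjN.
- by rewrite -(ip_S_hat_adj_feat H) final.
- by rewrite rhsE -ode// -(ip_S_hat_adj_feat H) S_hat_adjN.
- by rewrite ip_S_hat_adj_feat final.
Qed.
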